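(* Let $k,n\in\mathbb{N}$ and $w\in\{0,1\}^{k+n}$ be such that $w_{[0,n)}=w_{[k,k+n)}$ and there exists $i<k$ with $\xi(w_{[i,i+n)})=1$. Then there exists $j<k$ with $\xi(w_{[j,j+n)})=-1$.
   Context: For a string $w=w_0\dots w_{\#w-1}$, $w_{[a,b)}=w_a\dots w_{b-1}$; $\#w$ is the length and $\varepsilon$ the empty string. For $\#w\ge1$, $l(w)$ is $w$ without its last letter and $r(w)$ is $w$ without its first letter. $T^n$ is the alternating string of length $n$ starting with $0$ ($T^0=\varepsilon$, $T^n=T^{n-1}0$ for odd $n$, $T^n=T^{n-1}1$ for even $n\ge2$) and $CT^n$ its letterwise complement. $\xi:\{0,1\}^*\to\{-1,0,1\}$: $\xi(\varepsilon)=0$; $\xi(w)=1$ if $w=T^k$, $k\ge2$ even; $\xi(w)=-1$ if $w=CT^k$, $k\ge2$ even; otherwise $\xi(w)=\operatorname{sgn}(\xi(l(w))+\xi(r(w)))$. *)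

(* Defs.v *)
From mathcomp Require Import all_boot all_order all_algebra.
Set Implicit Arguments.
Unset Strict Implicit.
Unset Printing Implicit Defensive.
Import Order.TTheory GRing.Theory Num.Theory.

(* Binary strings are of type [seq bool]; the letters 0 and 1 are [false] and
   [true]. *)

Definition factor (w : seq bool) (a b : nat) : seq bool :=
  take (b - a) (drop a w).

(* Only meaningful on nonempty strings. *)
Definition lstr (w : seq bool) : seq bool := take (size w).-1 w.
Definition rstr (w : seq bool) : seq bool := behead w.

(* The letter appended to T^n to form T^(n+1) is 0 iff n+1 is odd. *)
Fixpoint Tstr (n : nat) : seq bool :=
  if n is m.+1 then rcons (Tstr m) (~~ odd n) else [::].

Definition CTstr (n : nat) : seq bool := map negb (Tstr n).

(* As #T^k = #CT^k = k, the only candidate for k in "w = T^k" or "w = CT^k" is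
   #w. *)
Definition even_alternating (S : nat -> seq bool) (w : seq bool) : bool :=
  [&& 2 <= size w, ~~ odd (size w) & w == S (size w)].

(* The recursion of xi, on an upper bound of the length of the string;
   [xi_nil], [xi_T], [xi_CT] and [xi_rec] below are the defining clauses. *)
Fixpoint xi_bounded (m : nat) (w : seq bool) : int :=
  if m is m'.+1 then
    if w == [::] then 0%R
    else if even_alternating Tstr w then 1%R
    else if even_alternating CTstr w then (-1)%R
    else Num.sg (xi_bounded m' (lstr w) + xi_bounded m' (rstr w))%R
  else 0%R.

Definition xi (w : seq bool) : int := xi_bounded (size w) w.

Lemma size_T n : size (Tstr n) = n.
Proof. by elim: n => //= n IHn; rewrite size_rcons IHn. Qed.

Lemma size_CT n : size (CTstr n) = n.
Proof. by rewrite size_map size_T. Qed.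

Lemma even_alternatingP (S : nat -> seq bool) (w : seq bool) :
  (forall k, size (S k) = k) ->
  reflect (exists k, [/\ 2 <= k, ~~ odd k & w = S k]) (even_alternating S w).
Proof.
move=> sS; apply: (iffP and3P) => [[ge2 ev /eqP wS]|[k [ge2 ev ->]]].
  by exists (size w).
by rewrite sS.
Qed.

Lemma T_neq_CT k j : 0 < k -> Tstr k <> CTstr j.
Proof.
move=> k0 e; have ekj : k = j by rewrite -(size_T k) e size_CT.
have h m : head true (Tstr m.+1) = false.
  by elim: m => //= m; case: (rcons _ _).
move: k0 e; rewrite -ekj; case: k {ekj} => // k _ /(congr1 (head true)).
rewrite h /CTstr; move: (h k) (size_T k.+1).
by case: (Tstr k.+1) => //= a s ->.
Qed.

Lemma xi_nil : xi [::] = 0%R.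
Proof. by []. Qed.

Lemma xi_T k : 2 <= k -> ~~ odd k -> xi (Tstr k) = 1%R.
Proof.
move=> k2 ev; have Ek : even_alternating Tstr (Tstr k).
  by apply/(even_alternatingP _ size_T); exists k.
rewrite /xi size_T; case: k k2 {ev} Ek => // k _ Ek.
by rewrite [xi_bounded _ _]/= -/(Tstr k.+1) Ek -size_eq0 size_T.
Qed.

Lemma xi_CT k : 2 <= k -> ~~ odd k -> xi (CTstr k) = (-1)%R.
Proof.
move=> k2 ev; have Ek : even_alternating CTstr (CTstr k).
  by apply/(even_alternatingP _ size_CT); exists k.
have NT : even_alternating Tstr (CTstr k) = false.
  apply/(even_alternatingP _ size_T) => -[j [j2 _ e]].
  by apply: (@T_neq_CT j k); [exact: ltnW | rewrite e].
rewrite /xi size_CT; case: k k2 {ev} Ek NT => // k _ Ek NT.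
by rewrite [xi_bounded _ _]/= -/(Tstr k.+1) NT Ek -size_eq0 size_CT.
Qed.

Lemma xi_rec w : w <> [::] ->
  (forall k, 2 <= k -> ~~ odd k -> w <> Tstr k) ->
  (forall k, 2 <= k -> ~~ odd k -> w <> CTstr k) ->
  xi w = Num.sg (xi (lstr w) + xi (rstr w))%R.
Proof.
move=> w0 wT wCT.
have NT : even_alternating Tstr w = false.
  by apply/(even_alternatingP _ size_T) => -[k [k2 ev]]; exact: wT.
have NCT : even_alternating CTstr w = false.
  by apply/(even_alternatingP _ size_CT) => -[k [k2 ev]]; exact: wCT.
have sl : size (lstr w) = (size w).-1 by rewrite size_takel // leq_pred.
rewrite /xi sl size_behead; case: w w0 NT NCT {wT wCT sl} => // a s _ NT NCT.
by rewrite [size _]/= [LHS]/= NT NCT.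
Qed.

(* Main.v *)
Require Import Defs.
From mathcomp Require Import all_boot all_order all_algebra.
From mathcomp Require Import zify.

(** The hypothesis says that the factors of length [n] of [w] are the windows
    of length [n] of a [k]-periodic sequence [x].  If [xi v = 1] then
    [xi (l v)] and [xi (r v)] are nonnegative, even when [v] is alternating.
    Hence if [xi u = -1] for a window [u] that is not alternating, then one of
    the two windows extending [u] by a letter, to the left or to the right, has
    value [-1] too: otherwise both neighbours of [u] have value [1], so [l u]
    and [r u] have nonnegative values, and then so has [u].
    If [x i = 1] and [x (i + 2) = 0] for some [i], the window at [i] of length
    [3] starts such a chain, which reaches every length.  If there is no such
    [i], then periodicity gives [x (i + 2) = x i] for all [i]: either [x] is
    constant and [xi] vanishes, or [x] alternates and shifting a window by one
    negates its value. *)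

Set Implicit Arguments.
Unset Strict Implicit.
Unset Printing Implicit Defensive.
Import Order.TTheory GRing.Theory Num.Theory.

Definition window (x : nat -> bool) (i n : nat) : seq bool :=
  mkseq (fun j => x (i + j)) n.

Lemma Tstr_mkseq n : Tstr n = mkseq odd n.
Proof. by elim: n => //= n ->; rewrite mkseqS negbK. Qed.

Lemma CTstr_mkseq n : CTstr n = mkseq (negb \o odd) n.
Proof. by rewrite /CTstr Tstr_mkseq /mkseq -map_comp. Qed.

Lemma map_negbK : involutive (map negb).
Proof. by move=> w; rewrite -map_comp map_id_in // => b _ /=; rewrite negbK. Qed.

(** Complementation swaps the two base clauses, which exclude each other, and commutes with [lstr]
    and [rstr]; [Num.sg] is odd. *)
Lemma xi_negb w : xi (map negb w) = (- xi w)%R.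
Proof.
rewrite /xi size_map; move: (size w) => m; elim: m w => [|m IHm] w /=.
  by rewrite oppr0.
have ET : even_alternating Tstr (map negb w) = even_alternating CTstr w.
  by rewrite /even_alternating size_map /CTstr (can2_eq map_negbK map_negbK).
have EC : even_alternating CTstr (map negb w) = even_alternating Tstr w.
  rewrite /even_alternating size_map /CTstr.
  by rewrite (inj_eq (can_inj map_negbK)).
have -> : (map negb w == [::]) = (w == [::]) by case: w {ET EC}.
rewrite ET EC; case: ifP => _; first by rewrite oppr0.
have -> : lstr (map negb w) = map negb (lstr w).
  by rewrite /lstr size_map map_take.
have -> : rstr (map negb w) = map negb (rstr w) by rewrite /rstr behead_map.
rewrite !IHm -opprD sgrN.
case: ifP => [/and3P[s2 _ /eqP wC]|_]; last by case: ifP.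
case: ifP => // /and3P[_ _ /eqP wT].
by case: (@T_neq_CT (size w) (size w)); [exact: ltnW | rewrite -wT].
Qed.

Lemma xi_cases w : [\/ xi w = 0, xi w = 1 | xi w = -1]%R.
Proof.
rewrite /xi; case: (size w) => [|m] /=; first by constructor 1.
case: ifP => _; first by constructor 1.
case: ifP => _; first by constructor 2.
case: ifP => _; first by constructor 3.
by case: sgrP => _; [constructor 1 | constructor 2 | constructor 3].
Qed.

Section Windows.

Variable x : nat -> bool.

Local Notation f i n := (xi (window x i n)).

Lemma lstr_window i n : lstr (window x i n.+1) = window x i n.
Proof.
by rewrite /lstr size_mkseq /window mkseqS -cats1 take_size_cat // size_mkseq.
Qed.

Lemma rstr_window i n : rstr (window x i n.+1) = window x i.+1 n.
Proof.
rewrite /rstr /window /mkseq /= -[1]addn0 iotaDl -map_comp.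
by apply: eq_map => j /=; rewrite add1n addSnnS.
Qed.

(** Only alternating words of even length escape the recursion: for even [n] the length [n.+1] is
    odd, and for odd [n] the repeated letter breaks alternation. *)
Lemma xi_window_rec i n :
    (odd n -> exists2 j, i <= j < i + n & x j.+1 = x j) ->
  f i n.+1 = Num.sg (f i n + f i.+1 n)%R.
Proof.
move=> heq.
have noalt (g : nat -> bool) m : (forall j, g j.+1 = ~~ g j) ->
    ~~ odd m -> window x i n.+1 <> mkseq g m.
  move=> galt ev wg; have em : m = n.+1.
    by rewrite -(size_mkseq g m) -wg size_mkseq.
  have [|j /andP[lij ltj] xj] := heq; first by move: ev; rewrite em /= negbK.
  have wn l : l < n.+1 -> x (i + l) = g l.
    by move=> ltl; move/(congr1 (fun s => nth false s l)): wg;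
      rewrite em !nth_mkseq.
  have xj0 : x (i + (j - i)) = g (j - i) by apply: wn; lia.
  have : x (i + (j - i).+1) = g (j - i).+1 by apply: wn; lia.
  by rewrite addnS galt -xj0 subnKC // xj; case: (x j).
have w0 : window x i n.+1 <> [::] by [].
rewrite -(lstr_window i n) -(rstr_window i n); apply: (xi_rec w0) => m _ ev.
  by rewrite Tstr_mkseq; apply: noalt.
by rewrite CTstr_mkseq; apply: noalt => // j /=.
Qed.

Lemma xi_window_succ_alternating i n :
    (forall j, i <= j < i + n -> x j.+1 = ~~ x j) ->
  f i.+1 n = (- f i n)%R.
Proof.
move=> alt; rewrite -xi_negb; congr xi.
rewrite /window /mkseq -map_comp; apply/eq_in_map => j.
by rewrite mem_iota /= => ltj; rewrite addSn alt //; lia.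
Qed.

(** The two subwindows are complements of each other, so their values cancel. *)
Lemma xi_window_odd_alternating i n : odd n ->
    (forall j, i <= j < i + n.-1 -> x j.+1 = ~~ x j) ->
  f i n = 0%R.
Proof.
case: n => // n /= ev alt; rewrite xi_window_rec; last by rewrite (negPf ev).
by rewrite xi_window_succ_alternating // subrr sgr0.
Qed.

Lemma xi_window_pos i n : f i n.+1 = 1%R -> (0 <= f i n /\ 0 <= f i.+1 n)%R.
Proof.
have [oddn|evn] := boolP (odd n); last first.
  rewrite xi_window_rec ?(negPf evn) //.
  by case: (xi_cases (window x i n)) => ->;
    case: (xi_cases (window x i.+1 n)) => ->.
(* With a repeat the recursion applies. Without one the window is a base case, and its two
   subwindows are alternating of odd length, hence of value 0. *)
have [/existsP[j /eqP xj]|/existsPn alt] :=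
    boolP [exists j : 'I_n, x (i + j).+1 == x (i + j)].
  rewrite xi_window_rec => [|_].
    by case: (xi_cases (window x i n)) => ->;
      case: (xi_cases (window x i.+1 n)) => ->.
  by exists (i + j); rewrite // leq_addr ltn_add2l ltn_ord.
have alt' j : i <= j < i + n -> x j.+1 = ~~ x j.
  move=> /andP[lij ltj]; have ltn : j - i < n by lia.
  by have /= := alt (Ordinal ltn); rewrite subnKC //; do 2!case: (x _).
by split; rewrite xi_window_odd_alternating // => j hj; apply: alt'; lia.
Qed.

(** Both [j] and [j.+1] lie inside the window, so a repeat passes to every larger window and keeps
    the base clauses out along the chain. *)
Definition has_repeat i n := exists2 j, i <= j < i + n.-1 & x j.+1 = x j.

Lemma xi_window_neg_extend i n : has_repeat i.+1 n -> f i.+1 n = (-1)%R ->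
  f i n.+1 = (-1)%R \/ f i.+1 n.+1 = (-1)%R.
Proof.
case: n => [[j]|n rep fn]; first by rewrite addn0; lia.
have [j hj xj] := rep; rewrite /= in hj.
rewrite (@xi_window_rec i n.+1) => [|_]; last by exists j => //; lia.
rewrite (@xi_window_rec i.+1 n.+1) => [|_]; last by exists j => //; lia.
rewrite fn.
(* Added to -1, a neighbour's value 0 or -1 gives sign -1; only 1 cancels it. *)
case: (xi_cases (window x i n.+1)) => [->|fl|->]; [by left| |by left].
case: (xi_cases (window x i.+2 n.+1)) => [->|fr|->]; [by right| |by right].
have [_ pl] := xi_window_pos fl; have [pr _] := xi_window_pos fr.
move: fn; rewrite xi_window_rec; last by exists j.
by case: sgrP => //; lia.
Qed.

Lemma xi_window_const n : (forall i, x i.+1 = x i) -> forall i, f i n = 0%R.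
Proof.
move=> cst; elim: n => // n IHn i; rewrite xi_window_rec ?IHn // => oddn.
by exists i => //; case: n oddn {IHn} => // n _; lia.
Qed.

End Windows.

Section Periodic.

Variables (x : nat -> bool) (k : nat).
Hypotheses (k_gt0 : 0 < k) (xk : forall i, x (i + k) = x i).

Local Notation f i n := (xi (window x i n)).

Lemma periodicM m i : x (i + m * k) = x i.
Proof.
elim: m => [|m IHm]; first by rewrite mul0n addn0.
by rewrite mulSn addnCA addnC xk.
Qed.

Lemma periodic_modn i j : x (i %% k + j) = x (i + j).
Proof. by rewrite -(periodicM (i %/ k)) addnAC (addnC (i %% k)) -divn_eq. Qed.

Lemma window_periodic i n : window x (i + k) n = window x i n.
Proof. by apply: eq_mkseq => j; rewrite addnAC xk. Qed.

Lemma window_modn i n : window x (i %% k) n = window x i n.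
Proof. by apply: eq_mkseq => j; exact: periodic_modn. Qed.

Lemma has_repeat_periodic i n : has_repeat x i n -> has_repeat x (i + k) n.
Proof.
by case=> j hj xj; exists (j + k); [lia | rewrite -addSn !xk].
Qed.

Lemma exists_xi_neg i n : x i -> ~~ x i.+2 -> 1 < n ->
  exists j, f j n = (-1)%R.
Proof.
move=> x0 x2; rewrite leq_eqVlt => /predU1P[<-|].
  (* Length 2 stands apart: the word 10 has value -1 but no repeat, so it cannot start the chain. *)
  case x1: (x i.+1); [exists i.+1 | exists i];
    by rewrite /window /mkseq /= ?addn0 ?addn1 ?x0 ?x1 ?(negPf x2).
move=> n3; suff [j _ fj] : exists2 j, has_repeat x j n & f j n = (-1)%R.
  by exists j.
elim: n n3 => // n IHn; rewrite ltnS leq_eqVlt => /predU1P[<-|/IHn[j rj fj]].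
  (* The chain starts at 100 or 110, whose subwords 10 and 00, or 11 and 10, have values summing to
     -1. *)
  exists i; last first.
    by rewrite /window /mkseq /= addn0 addn1 addn2 x0 (negPf x2); case: (x _).
  case x1: (x i.+1).
    by exists i; [lia | rewrite x0 x1].
  by exists i.+1; [lia | rewrite x1 (negPf x2)].
(* Moving one period to the right makes room for an extension to the left. *)
have [l jkl] : exists l, j + k = l.+1 by exists (j + k).-1; lia.
have := has_repeat_periodic rj; rewrite jkl => rl.
have fl : f l.+1 n = (-1)%R by rewrite -jkl window_periodic.
case: rl (rl) => m hm xm /xi_window_neg_extend/(_ fl)[ext|ext].
  by exists l => //; exists m => //; lia.
by exists l.+1 => //; exists m => //; lia.
Qed.

Lemma two_periodic : (forall i, x i -> x i.+2) -> forall i, x i.+2 = x i.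
Proof.
move=> mono i; apply/idP/idP; last exact: mono.
have up m j : x j -> x (j + m.*2).
  by elim: m => [|m IHm] xj; rewrite ?addn0 // doubleS !addnS; apply/mono/IHm.
(* From [i.+2], another [k.-1] steps of length 2 reach [i + 2 * k], two full periods after [i],
   whatever the parity of [k]. *)
move=> /(up k.-1); rewrite -(periodicM 2 i).
by have -> : i.+2 + k.-1.*2 = i + 2 * k by lia.
Qed.

Lemma exists_xi_neg_of_pos i n : f i n = 1%R -> exists j, f j n = (-1)%R.
Proof.
move=> fi.
have n2 : 1 < n by case: n fi => [|[|n]].
have [/existsP[j /andP[xj xj2]]|/existsPn H] :=
    boolP [exists j : 'I_k, x j && ~~ x j.+2].
  exact: exists_xi_neg xj xj2 n2.
have x2 : forall j, x j.+2 = x j.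
  apply: two_periodic => j; have := H (Ordinal (ltn_pmod j k_gt0)).
  have := periodic_modn j 0; have := periodic_modn j 2.
  by rewrite !addn0 !addn2 /= => -> ->; case: (x j) => //=; rewrite negbK.
(* [b = false] is the constant case, [b = true] the alternating one. *)
have step (b : bool) : x 1 = b (+) x 0 -> forall j, x j.+1 = b (+) x j.
  by move=> x1; elim=> // j IHj; rewrite x2 IHj; case: (b); case: (x j).
have [x01|x01] := eqVneq (x 1) (x 0).
  by move: fi; rewrite xi_window_const //; exact: (step false).
exists i.+1; rewrite xi_window_succ_alternating ?fi // => j _.
by apply: (step true); move: x01; case: (x 1); case: (x 0).
Qed.

End Periodic.

(** Position [m - k] of the two equal factors identifies letters [m - k] and [m] of [w], so [m]
    descends by [k] until it is below [k]. *)
Lemma nth_modn_periodic k n (w : seq bool) (hk : 0 < k) :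
    factor w 0 n = factor w k (k + n) ->
  forall m, m < k + n -> nth false w (m %% k) = nth false w m.
Proof.
move=> hw m; elim/ltn_ind: m => m IHm ltm.
have [ltmk|lekm] := ltnP m k; first by rewrite modn_small.
rewrite -(subnK lekm) modnDr IHm; [|lia..].
have := congr1 (fun s => nth false s (m - k)) hw.
rewrite /factor subn0 drop0 addKn !nth_take ?nth_drop; [|lia..].
by rewrite addnC.
Qed.

Theorem theorem2p17 (k n : nat) (w : (k + n).-tuple bool)
    (hw : factor w 0 n = factor w k (k + n))
    (hpos : exists i : nat, i < k /\ xi (factor w i (i + n)) = 1%R) :
  exists j : nat, j < k /\ xi (factor w j (j + n)) = (-1)%R.
Proof.
have [i [ltik fi]] := hpos; have k_gt0 : 0 < k by case: k ltik {hpos fi w hw}.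
pose x j := nth false w (j %% k).
have xk j : x (j + k) = x j by rewrite /x modnDr.
have win j : j < k -> factor w j (j + n) = window x j n.
  move=> ltjk; have sn : size (factor w j (j + n)) = n.
    by rewrite size_takel ?size_drop ?size_tuple; lia.
  apply: (@eq_from_nth _ false); rewrite sn ?size_mkseq // => l ltl.
  rewrite nth_mkseq // /factor addKn nth_take // nth_drop.
  by rewrite /x (nth_modn_periodic k_gt0 hw) //; lia.
rewrite win // in fi; have [j fj] := exists_xi_neg_of_pos k_gt0 xk fi.
(* The window found may start anywhere in [x]; reducing its start modulo [k] brings it back to a
   factor of [w]. *)
exists (j %% k); have ltj := ltn_pmod j k_gt0.
by rewrite win // window_modn.
Qed.
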